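(* For every graph $G$, $\chi^\star_c(G) \le 1+\Delta(G) + \chi_c(G)$.
   Context: Graphs are finite and simple; $\Delta(G)$ is the maximum degree of $G$. A $k$-fold correspondence-cover of $G$ via $L$ is a graph $H$ together with a mapping $L:V(G)\to 2^{V(H)}$ such that the sets $L(v)$, $v\in V(G)$, partition $V(H)$, $|L(v)|=k$ for every $v$, for every edge $vv'\in E(G)$ the edges of $H$ between $L(v)$ and $L(v')$ form a (possibly empty) matching, and for distinct nonadjacent $v,v'$ there is no edge of $H$ between $L(v)$ and $L(v')$. An independent transversal of $H$ with respect to $L$ (a correspondence $L$-colouring) is a set consisting of exactly one vertex from each $L(v)$ having no two members $x\in L(v)$, $y\in L(v')$ (with $v\neq v'$) adjacent in $H$. The correspondence chromatic number $\chi_c(G)$ is the least $k$ such that every $k$-fold correspondence-cover $H$ of $G$ via any $L$ admits a correspondence $L$-colouring. A ($k$-fold) correspondence $L$-packing of $H$ is a collection of $k$ mutually disjoint correspondence $L$-colourings. The correspondence packing number $\chi^\star_c(G)$ is the least $k$ such that every $k$-fold correspondence-cover $H$ of $G$ via any $L$ admits a $k$-fold correspondence $L$-packing. *)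

(* Defs.v *)
From mathcomp Require Import all_boot all_fingroup.
From mathcomp Require Import boolp.

Set Implicit Arguments.
Unset Strict Implicit.
Unset Printing Implicit Defensive.

Local Open Scope nat_scope.

Record sgraph := SGraph {
  vertex :> finType;
  adj : rel vertex;
  adj_sym : symmetric adj;
  adj_irrefl : irreflexive adj }.

Definition max_degree (G : sgraph) : nat :=
  \max_(v : G) #|[set w : G | adj v w]|.

Definition edges_between (H : sgraph) (A B : {set H}) : {set {set H}} :=
  [set [set x; y] | x in A, y in B & adj x y].

(* A set of edges (two-element sets of vertices) is a matching when its members
   are pairwise disjoint, i.e. [trivIset].  Being a partition is spelled out
   because [partition] would exclude empty classes, which occur when k = 0.
   Edges of H inside a single L v are unrestricted. *)
Record correspondence_cover (k : nat) (G H : sgraph) (L : G -> {set H}) : Prop :=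
  CorrespondenceCover {
    cover_disjoint : forall v w : G, v != w -> [disjoint L v & L w];
    cover_full : \bigcup_(v : G) L v = [set: H];
    cover_card : forall v : G, #|L v| = k;
    cover_matching :
      forall v w : G, adj v w -> trivIset (edges_between (L v) (L w));
    cover_nonadj :
      forall v w : G, v != w -> ~~ adj v w -> edges_between (L v) (L w) = set0 }.

Definition correspondence_colouring (G H : sgraph) (L : G -> {set H})
    (S : {set H}) : Prop :=
  (forall v : G, #|S :&: L v| = 1) /\
  (forall (v w : G) (x y : H), v != w ->
     x \in S :&: L v -> y \in S :&: L w -> ~~ adj x y).

Definition correspondence_packing (k : nat) (G H : sgraph) (L : G -> {set H})
    (S : 'I_k -> {set H}) : Prop :=
  (forall i : 'I_k, correspondence_colouring L (S i)) /\
  (forall i j : 'I_k, i != j -> [disjoint S i & S j]).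

Definition correspondence_colourable (k : nat) (G : sgraph) : Prop :=
  forall (H : sgraph) (L : G -> {set H}), correspondence_cover k L ->
    exists S : {set H}, correspondence_colouring L S.

Definition correspondence_packable (k : nat) (G : sgraph) : Prop :=
  forall (H : sgraph) (L : G -> {set H}), correspondence_cover k L ->
    exists S : 'I_k -> {set H}, correspondence_packing L S.

Lemma edges_between_unique (k : nat) (G H : sgraph) (L : G -> {set H})
    (v w : G) (x y z : H) :
  correspondence_cover k L -> v != w ->
  x \in L v -> y \in L w -> z \in L w -> adj x y -> adj x z -> y = z.
Proof.
move=> cL nvw xv yw zw xy xz.
have e1 : [set x; y] \in edges_between (L v) (L w).
  by apply/imset2P; exists x y => //; rewrite inE yw.
have e2 : [set x; z] \in edges_between (L v) (L w).
  by apply/imset2P; exists x z => //; rewrite inE zw.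
have [avw|navw] := boolP (adj v w); last first.
  by move: e1; rewrite (cover_nonadj cL nvw navw) inE.
have /trivIsetP/(_ _ _ e1 e2) tr := cover_matching cL avw.
have [E|/tr] := eqVneq [set x; y] [set x; z]; last first.
  by move=> /disjointFr/(_ (set21 x y)); rewrite set21.
move: (set22 x y); rewrite E !inE => /orP[/eqP yx|/eqP //].
by move: xy; rewrite yx adj_irrefl.
Qed.

Lemma avoiding_perm (k d : nat) (bad : rel 'I_k) :
  d.*2 < k ->
  (forall i, #|[set j | bad i j]| <= d) ->
  (forall j, #|[set i | bad i j]| <= d) ->
  exists s : {perm 'I_k}, forall i, ~~ bad i (s i).
Proof.
move=> dk rowd cold.
pose confl (s : {perm 'I_k}) := [set i | bad i (s i)].
case: (@arg_minnP _ (1%g : {perm 'I_k}) xpredT (fun s => #|confl s|) isT).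
move=> s _ smin; exists s => i; apply/negP => bi.
have [j] : exists j, j \notin
    (s @^-1: [set j | bad i j]) :|: [set l | bad l (s i)].
  apply/existsP; rewrite -negb_forall; apply/negP => /forallP allb.
  have : k <= d.*2.
    rewrite -{1}(card_ord k) -cardsT -addnn.
    apply: leq_trans (leq_add (rowd i) (cold (s i))).
    rewrite -(card_preimset [set j | bad i j] (@perm_inj _ s)).
    apply: leq_trans (leq_card_setU _ _); apply: subset_leq_card.
    by apply/subsetP => l _; apply: allb.
  by rewrite leqNgt dk.
rewrite !inE negb_or => /andP[nij nji].
have ij : i != j by apply: contraNneq nij => <-.
have : confl (tperm i j * s)%g \proper confl s.
  apply/properP; split; last by exists i; rewrite inE // permM tpermL.
  apply/subsetP => l; rewrite !inE permM.
  by case: tpermP => [->|->|//]; [rewrite (negPf nij)|rewrite (negPf nji)].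
by move=> /proper_card; rewrite ltnNge smin.
Qed.

Lemma card_exists_le (T I : finType) (r : seq I) (P : I -> pred T) :
  (forall i, i \in r -> #|[set x | P i x]| <= 1) ->
  #|[set x | has (P^~ x) r]| <= size r.
Proof.
elim: r => [|i r IH] Pr.
  by rewrite leqn0 cards_eq0; apply/eqP/setP=> x; rewrite !inE.
have -> : [set x | has (P^~ x) (i :: r)] =
  [set x | P i x] :|: [set x | has (P^~ x) r] by apply/setP=> x; rewrite !inE.
apply: leq_trans (leq_card_setU _ _) _; rewrite /= -add1n leq_add //.
  by apply: Pr; rewrite mem_head.
by apply: IH => l lr; apply: Pr; rewrite inE lr orbT.
Qed.

(* The minima below range over nonempty sets: colour the vertices one at a time,
   permuting the colours of each new list to avoid all conflicts. *)
Lemma correspondence_packable_large (G : sgraph) :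
  correspondence_packable (#|G|.*2).+1 G.
Proof.
set k := (#|G|.*2).+1 => H L cL.
have step (s : seq G) : uniq s -> exists f : G -> 'I_k -> H,
    [/\ forall v, injective (f v), forall v i, f v i \in L v
      & {in s &, forall v w, v != w -> forall i, ~~ adj (f v i) (f w i)}].
  elim: s => [_|v s IH /= /andP[vs us]].
    exists (fun v i => enum_val (cast_ord (esym (cover_card cL v)) i)).
    by split=> // [v i j /enum_val_inj/cast_ord_inj|v i]; rewrite ?enum_valP.
  have [f [finj fL fs]] := IH us.
  have sG : size s <= #|G| by rewrite -(card_uniqP us) max_card.
  have nv w : w \in s -> v != w by move=> ws; apply: contraNneq vs => ->.
  pose bad i j := has (fun w => adj (f v j) (f w i)) s.
  have [|i|j|t tP] := @avoiding_perm k (size s) bad.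
  - by rewrite ltnS leq_double.
  - apply: card_exists_le => w ws; apply/card_le1_eqP => j l; rewrite !inE.
    move=> aj al; apply: (finj v).
    by apply: (edges_between_unique cL _ (fL w i) (fL v _) (fL v _));
       rewrite 1?eq_sym ?nv // 1?adj_sym.
  - apply: card_exists_le => w ws; apply/card_le1_eqP => i l; rewrite !inE.
    move=> ai al; apply: (finj w).
    by apply: (edges_between_unique cL (nv w ws) (fL v j) (fL w _) (fL w _)).
  exists (fun u i => if u == v then f v (t i) else f u i); split.
  - by move=> u i j; case: eqP => _ /finj // /perm_inj.
  - by move=> u i; case: eqP => [->|_]; apply: fL.
  - have av w i : w \in s -> ~~ adj (f v (t i)) (f w i).
      by move=> ws; have /hasPn/(_ w ws) := tP i.
    move=> u w; rewrite !inE.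
    have [->|nu] := eqVneq u v; have [->|nw] := eqVneq w v => //=.
    + by move=> _ ws _ i; apply: av.
    + by move=> us' _ _ i; rewrite adj_sym; apply: av.
    + by move=> us' ws nuw i; apply: fs.
have [f [finj fL fs]] := step (enum G) (enum_uniq G).
have fLE u v i : (f u i \in L v) = (u == v).
  apply/idP/eqP => [fv|<-]; last exact: fL.
  apply: contraTeq fv => nuv.
  by rewrite (disjointFr (cover_disjoint cL nuv) (fL u i)).
exists (fun i => [set f v i | v : G]); split=> [i|i j nij].
  split=> [v|v w x y nvw].
    apply/eqP/cards1P; exists (f v i); apply/setP => x; rewrite !inE.
    apply/andP/eqP => [[/imsetP[u _ ->]]|->].
      by rewrite fLE => /eqP ->.
    by rewrite fL imset_f.
  rewrite !inE => /andP[/imsetP[v' _ ->]]; rewrite fLE => /eqP ->.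
  move=> /andP[/imsetP[w' _ ->]]; rewrite fLE => /eqP ->.
  by apply: fs; rewrite ?mem_enum.
rewrite -setI_eq0; apply/eqP/setP => x; rewrite !inE; apply/negP.
move=> /andP[/imsetP[v _ ->] /imsetP[w _ E]].
have /eqP vw : v == w by rewrite -(fLE v w i) E fL.
by move: nij; rewrite -vw in E; rewrite (finj _ _ _ E) eqxx.
Qed.

Lemma correspondence_colourable_exists (G : sgraph) :
  exists k, `[< correspondence_colourable k G >].
Proof.
exists (#|G|.*2).+1; apply/asboolP => H L cL.
have [S [SP _]] := @correspondence_packable_large G H L cL.
by exists (S ord0).
Qed.

Lemma correspondence_packable_exists (G : sgraph) :
  exists k, (0 < k) && `[< correspondence_packable k G >].
Proof.
exists (#|G|.*2).+1; apply/asboolP; exact: correspondence_packable_large.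
Qed.

Definition correspondence_chromatic_number (G : sgraph) : nat :=
  ex_minn (correspondence_colourable_exists G).

(* Restricted to k > 0: a 0-fold packing is an empty family of colourings, which
   always exists.  For the chromatic number no such restriction is needed, since
   a nonempty graph is never 0-colourable. *)
Definition correspondence_packing_number (G : sgraph) : nat :=
  ex_minn (correspondence_packable_exists G).

(* Main.v *)
Require Import Defs.
From mathcomp Require Import all_boot.
From mathcomp Require Import boolp.

(** Let m be the correspondence chromatic number of G, let D be its maximum
    degree and let k = 1 + D + m.  Every k-fold cover is packable, by an
    exchange argument of the kind that Aharoni, Berger and Ziv used to bound the
    strong chromatic number.

    A packing in progress is a partial assignment of k columns to the vertices
    of H: within a list no column is used twice, and each column is independent.
    Take such an assignment with some vertex x left without a column; by
    counting, some column a is absent from the list of x.  The idea is to give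
    column a to the vertices of a whole new transversal T through x, and to
    repair each other list u by handing the former column of T u, say b, to the
    former a-vertex y of u.  The new a-class is T, hence independent.  A new
    b-class consists of old b-vertices and of old a-vertices; each kind is
    independent, so the only danger is an edge from y to an old b-vertex in
    another list.  Since y has at most one neighbour in each of at most D other
    lists, at most D choices of T u are dangerous ([swap_blocked_card]).

    Besides these, T u must not be adjacent to x, which excludes at most one
    more vertex.  So every list keeps at least m candidates, and colourability
    with m colours provides T ([transversal_through]).  The exchange keeps the
    assignment valid ([swap_column_packing]) and lowers the number of vertices
    without a column, since x gains one ([swap_column_uncoloured]).  Once no
    vertex lacks a column, the columns are the colourings of a packing
    ([full_partial_packing]). *)

Set Implicit Arguments.
Unset Strict Implicit.
Unset Printing Implicit Defensive.

Local Open Scope nat_scope.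

(** * Transversals chosen from sublists *)

(** Replaces the family L by the projection from H to G, so that two vertices
    of H can be tested for lying in the same list. *)
Lemma cover_owner (k : nat) (G H : sgraph) (L : G -> {set H}) :
  correspondence_cover k L ->
  exists p : H -> G, forall x v, (x \in L v) = (p x == v).
Proof.
move=> cL.
have /fin_all_exists[p pP] (x : H) : exists v, x \in L v.
  have : x \in \bigcup_v L v by rewrite (cover_full cL) inE.
  by case/bigcupP => v _ xv; exists v.
exists p => x v; apply/idP/eqP => [xv|<-]; last exact: pP.
apply: contraTeq xv => pxv.
by rewrite (disjointFr (cover_disjoint cL pxv) (pP x)).
Qed.

Lemma subset_of_card (T : finType) (A : {set T}) (m : nat) :
  m <= #|A| -> exists2 B : {set T}, B \subset A & #|B| = m.
Proof.
case/card_geqP => s [us <- sA]; exists [set x in s].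
  by apply/subsetP => x; rewrite inE; apply: sA.
by rewrite cardsE; apply/card_uniqP.
Qed.

Definition induced (H : sgraph) (A : {set H}) : sgraph :=
  @SGraph {x : H | x \in A} (fun x y => adj (val x) (val y))
    (fun x y => adj_sym (val x) (val y)) (fun x => adj_irrefl (val x)).

(** Each cover axiom is inherited because an edge of the induced subgraph between
    two sublists is, through the injection [val], an edge of H between the full
    lists. *)
Lemma subcover (k m : nat) (G H : sgraph) (L M : G -> {set H}) :
  correspondence_cover k L ->
  (forall v, M v \subset L v) -> (forall v, #|M v| = m) ->
  correspondence_cover m
    (fun v => [set x : induced (\bigcup_v M v) | val x \in M v]).
Proof.
move=> cL ML cM; set A := \bigcup_v M v.
have edgeL v w e :
    e \in edges_between [set x : induced A | val x \in M v]
            [set x : induced A | val x \in M w] ->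
    val @: e \in edges_between (L v) (L w).
  case/imset2P => x y; rewrite !inE => xv /andP[yw xy] ->.
  rewrite imsetU1 imset_set1; apply/imset2P; exists (val x) (val y) => //.
    exact: (subsetP (ML v)).
  by rewrite inE (subsetP (ML w)).
split.
- move=> v w vw; rewrite -setI_eq0; apply/eqP/setP => x; rewrite !inE.
  apply/negP => /andP[xv xw].
  by have := disjointFr (cover_disjoint cL vw) (subsetP (ML v) _ xv);
     rewrite (subsetP (ML w)).
- apply/setP => x; rewrite !inE; have /bigcupP[v _ xv] := valP x.
  by apply/bigcupP; exists v => //; rewrite inE.
- move=> v; rewrite -(cM v) -(card_imset _ val_inj); apply: eq_card => x.
  apply/imsetP/idP => [[y]|xv]; first by rewrite inE => yv ->.
  have xA : x \in A by apply/bigcupP; exists v.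
  by exists (Sub x xA); rewrite ?inE SubK.
- move=> v w vw; apply/trivIsetP => e f /edgeL eL /edgeL fL ef.
  have /trivIsetP/(_ _ _ eL fL) := cover_matching cL vw.
  rewrite (inj_eq (imset_inj val_inj)) => /(_ ef).
  by rewrite imset_disjoint //; exact: val_inj.
- move=> v w vw nvw; apply/setP => e; rewrite inE.
  by apply/negP => /edgeL; rewrite (cover_nonadj cL vw nvw) inE.
Qed.

(** Colourability speaks only of covers whose lists have exactly m elements and
    exhaust the cover graph: shrink each M v to m elements and pass to the
    induced subgraph. *)
Lemma transversal_of_sublists (k m : nat) (G H : sgraph) (L M : G -> {set H}) :
  correspondence_cover k L -> correspondence_colourable m G ->
  (forall v, M v \subset L v) -> (forall v, m <= #|M v|) ->
  exists T : G -> H, (forall v, T v \in M v) /\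
    (forall v w, v != w -> ~~ adj (T v) (T w)).
Proof.
move=> cL colG ML mM.
have /fin_all_exists2[N NM cN] v := subset_of_card (mM v).
have NL v : N v \subset L v by apply: subset_trans (NM v) (ML v).
have [S [S1 Sind]] := colG _ _ (subcover cL NL cN).
have /fin_all_exists[T TP] v : exists x,
    x \in S :&: [set x : induced (\bigcup_v N v) | val x \in N v].
  by apply/set0Pn; rewrite -card_gt0 S1.
exists (fun v => val (T v)); split=> [v|v w vw]; last exact: (Sind _ _ _ _ vw).
by apply: (subsetP (NM v)); have := TP v; rewrite !inE => /andP[].
Qed.

(** * Partial packings and blocked exchanges *)

(** The value [None] marks a vertex of H that has no column yet. *)
Record partial_packing (k : nat) (G H : sgraph) (p : H -> G)
    (c : H -> option 'I_k) : Prop := PartialPacking {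
  partial_packing_inj : forall x y i,
    p x = p y -> c x = Some i -> c y = Some i -> x = y;
  partial_packing_indep : forall x y i,
    p x != p y -> c x = Some i -> c y = Some i -> ~~ adj x y }.

(** The k - 1 other vertices of the list carry at most k - 1 of the k columns. *)
Lemma missing_column (k : nat) (G H : sgraph) (L : G -> {set H})
    (c : H -> option 'I_k) (v : G) (x : H) :
  correspondence_cover k L -> x \in L v -> c x = None ->
  exists a : 'I_k, forall y, y \in L v -> c y != Some a.
Proof.
move=> cL xv cx.
suff /existsP[a /forall_inP aP] :
    [exists a : 'I_k, forall y in L v, c y != Some a] by exists a.
apply: contraT; rewrite negb_exists => /forallP noa.
suff : k < k by rewrite ltnn.
rewrite -{2}(cover_card cL v) (cardsD1 x) xv add1n ltnS -{1}(card_ord k).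
rewrite -cardsT -(card_imset _ (@Some_inj _)).
apply: leq_trans (leq_imset_card c (mem (L v :\ x))); apply: subset_leq_card.
apply/subsetP => _ /imsetP[a _ ->].
have := noa a; rewrite negb_forall => /existsP[y].
rewrite negb_imply negbK => /andP[yv /eqP cy].
apply/imsetP; exists y => //; rewrite !inE yv andbT.
by apply: contra_eq_neq cy => ->; rewrite cx.
Qed.

(** In the list of u, y is the vertex of column a.  Giving column a to z and the
    column of z to y is unsafe exactly when y has a neighbour y' in another list
    that already has the column of z.  If the list of u has no vertex in column
    a, nothing is blocked. *)
Definition swap_blocked (k : nat) (G H : sgraph) (p : H -> G)
    (c : H -> option 'I_k) (a : 'I_k) (u : G) : {set H} :=
  [set z | (p z == u) && [exists y, exists y',
     [&& p y == u, c y == Some a, p y' != u, adj y y', c z != None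
       & c z == c y']]].

(** The vertex y of column a in the list of u is unique.  The matching between
    this list and that of a neighbour w of u leaves at most one y' in the list of
    w, and the column of y' occurs at most once in the list of u: each of the at
    most [max_degree G] neighbours w accounts for at most one blocked vertex. *)
Lemma swap_blocked_card (k : nat) (G H : sgraph) (L : G -> {set H}) (p : H -> G)
    (c : H -> option 'I_k) (a : 'I_k) (u : G) :
  correspondence_cover k L -> (forall x v, (x \in L v) = (p x == v)) ->
  partial_packing p c -> #|swap_blocked p c a u| <= max_degree G.
Proof.
move=> cL pP [cinj _].
pose P w := [pred z | (p z == u) && [exists y, exists y',
  [&& p y == u, c y == Some a, p y' == w, adj y y', c z != None & c z == c y']]].
have degu : size (enum [set w : G | adj u w]) <= max_degree G.
  by rewrite -cardE; apply: (leq_bigmax u).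
apply: leq_trans degu; apply: leq_trans (@card_exists_le H G _ P _).
  apply: subset_leq_card; apply/subsetP => z; rewrite !inE.
  case/andP => pz /existsP[y /existsP[y' /and5P[py cy py' yy' cz]]].
  apply/hasP; exists (p y'); last first.
    rewrite /= pz; apply/existsP; exists y; apply/existsP; exists y'.
    by rewrite py cy yy' eqxx.
  rewrite mem_enum inE; apply: contraT => nadj.
  rewrite eq_sym in py'; have := cover_nonadj cL py' nadj.
  move/setP/(_ [set y; y']); rewrite inE => <-.
  by apply/imset2P; exists y y' => //; rewrite ?inE pP // yy' eqxx.
move=> w; rewrite mem_enum inE => uw; apply/card_le1_eqP => z1 z2.
have nuw : u != w by apply: contraTneq uw => ->; rewrite adj_irrefl.
rewrite !inE.
case/andP => /eqP pz1 /existsP[y1 /existsP[y1' /and5P[]]].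
move=> /eqP py1 /eqP cy1 /eqP py1' adj1 /andP[cz1 /eqP cy1'].
case/andP => /eqP pz2 /existsP[y2 /existsP[y2' /and5P[]]].
move=> /eqP py2 /eqP cy2 /eqP py2' adj2 /andP[cz2 /eqP cy2'].
have y12 : y1 = y2 by apply: (cinj _ _ a); rewrite ?py1.
rewrite -{}y12 in adj2.
have y12' : y1' = y2'.
  by apply: (edges_between_unique cL nuw _ _ _ adj1 adj2);
    rewrite pP ?py1 ?py1' ?py2'.
case e : (c z1) cz1 => [i|//] _.
by apply: (cinj _ _ i); rewrite ?pz1 ?pz2 // cy2' -y12' -cy1'.
Qed.

(** The bound 1 + max_degree G + m is spent here: in a list other than that of x,
    at most [max_degree G] vertices are blocked and at most one is adjacent to x.
    The list of x itself is left whole, because whatever transversal comes out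
    can be made to pass through x afterwards: all its other members avoid the
    neighbours of x. *)
Lemma transversal_through (m : nat) (G H : sgraph) (L : G -> {set H})
    (p : H -> G) (c : H -> option 'I_(1 + max_degree G + m))
    (a : 'I_(1 + max_degree G + m)) (x : H) :
  correspondence_cover (1 + max_degree G + m) L ->
  (forall x v, (x \in L v) = (p x == v)) ->
  correspondence_colourable m G -> partial_packing p c ->
  (forall y, p y = p x -> c y != Some a) ->
  exists T : G -> H, [/\ T (p x) = x,
    forall v, p (T v) = v /\ T v \notin swap_blocked p c a v
    & forall v w, v != w -> ~~ adj (T v) (T w)].
Proof.
move=> cL pP colG cP xa.
pose M v := if v == p x then L v
  else L v :\: (swap_blocked p c a v :|: [set y | (p y == v) && adj x y]).
have ML v : M v \subset L v by rewrite /M; case: ifP => // _; apply: subsetDl.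
have mM v : m <= #|M v|.
  rewrite /M; case: eqVneq => [_|vx]; first by rewrite (cover_card cL) leq_addl.
  set B := _ :|: _; have cB : #|B| <= 1 + max_degree G.
    apply: leq_trans (leq_card_setU _ _) _; rewrite addnC leq_add //; last first.
      exact: swap_blocked_card cL pP cP.
    apply/card_le1_eqP => y z; rewrite !inE => /andP[py xy] /andP[pz xz].
    rewrite eq_sym in vx.
    by apply: (edges_between_unique cL vx _ _ _ xz xy); rewrite pP.
  rewrite -(leq_add2l #|B|); apply: leq_trans (_ : #|L v| <= _).
    by rewrite (cover_card cL) leq_add2r.
  by rewrite -(cardsID B (L v)) leq_add2r subset_leq_card ?subsetIr.
have [T [TM Tind]] := transversal_of_sublists cL colG ML mM.
have pT v : p (T v) = v.
  by apply/eqP; rewrite -pP; apply: (subsetP (ML v)).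
have Tx v : v != p x -> ~~ adj x (T v).
  by have := TM v; rewrite /M; case: eqP => // _; rewrite !inE pT eqxx /= negb_or;
     case/andP => /andP[].
exists (fun v => if v == p x then x else T v); split.
- by rewrite eqxx.
- move=> v; case: eqVneq => [->|vx]; split=> //.
    (* Nothing is blocked in the list of x, where column a is absent. *)
    rewrite inE eqxx /=; apply/existsP => -[y /existsP[y' /and3P[/eqP py]]].
    by rewrite (negPf (xa _ py)).
  by have := TM v; rewrite /M (negPf vx) in_setD in_setU negb_or; case/andP => /andP[].
- move=> v w; have [->|vx] := eqVneq v (p x); have [wx|wx] := eqVneq w (p x).
  + by [].
  + by move=> _; apply: Tx.
  + by move=> _; rewrite adj_sym; apply: Tx.
  + exact: Tind.
Qed.

(** * Exchanging a column with a transversal *)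

(** If the vertex T u has no column, the former a-vertex of the list of u loses
    its own: the column passed on is the option [c (T (p y))]. *)
Definition swap_column (k : nat) (G H : sgraph) (p : H -> G)
    (c : H -> option 'I_k) (a : 'I_k) (T : G -> H) (y : H) : option 'I_k :=
  if y == T (p y) then Some a else if c y == Some a then c (T (p y)) else c y.

(** Two vertices newly placed in the same column b both come from column a, and
    are therefore nonadjacent.  A conflict between a newly placed vertex and one
    that kept column b is what the blocked sets exclude. *)
Lemma swap_column_packing (k : nat) (G H : sgraph) (p : H -> G)
    (c : H -> option 'I_k) (a : 'I_k) (T : G -> H) :
  partial_packing p c ->
  (forall v, p (T v) = v /\ T v \notin swap_blocked p c a v) ->
  (forall v w, v != w -> ~~ adj (T v) (T w)) ->
  partial_packing p (swap_column p c a T).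
Proof.
move=> [cinj cind] TP Tind.
have pT v : p (T v) = v by case: (TP v).
(* After the exchange, column a is exactly T: an old a-vertex y can keep it
   only if T (p y) had it too, and then y is T (p y). *)
have only_T y i : y <> T (p y) -> swap_column p c a T y = Some i -> i <> a.
  rewrite /swap_column => yT; case: eqP => [//|_].
  case: eqP => [cy|cy] ci ia; last by rewrite ci ia in cy.
  by apply: yT; apply: (cinj _ _ a); rewrite ?pT // ci ia.
have blocked y y' i : p y != p y' -> c y = Some a -> c (T (p y)) = Some i ->
    c y' = Some i -> ~~ adj y y'.
  move=> pyy' cy ci cy'; have [_] := TP (p y).
  apply: contra => yy'; rewrite inE pT eqxx /=.
  apply/existsP; exists y; apply/existsP; exists y'.
  by rewrite eqxx cy yy' ci cy' eq_sym pyy' !eqxx.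
split=> y y' i pyy' ci ci'; have := @only_T y i; have := @only_T y' i;
  move: ci ci'; rewrite /swap_column;
  case: (y =P _) => yT; case: (y' =P _) => yT'.
- by rewrite yT yT' pyy'.
- by move=> [->] ci /(_ yT' ci).
- by move=> ci [ai] _ /(_ yT ci); rewrite ai.
- case: eqP => [cy|_]; case: eqP => [cy'|_] ci ci' _ _.
  + exact: cinj cy cy'.
  + by case: yT'; apply: (cinj _ _ i); rewrite ?pT // -pyy'.
  + by case: yT; apply: (cinj _ _ i); rewrite ?pT // pyy'.
  + exact: cinj ci ci'.
- by rewrite yT yT' => *; apply: Tind.
- by move=> [->] ci /(_ yT' ci).
- by move=> ci [ai] _ /(_ yT ci); rewrite ai.
- case: eqP => [cy|_]; case: eqP => [cy'|_] ci ci' _ _.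
  + exact: cind cy cy'.
  + exact: blocked ci ci'.
  + by rewrite adj_sym; apply: blocked ci' ci; rewrite // eq_sym.
  + exact: cind ci ci'.
Qed.

(** Within a list, a vertex is deprived of its column only if the member of T
    there gained one.  So the vertices without a column afterwards inject into
    those without one before; x is not in the image, because its list has no
    a-vertex to deprive. *)
Lemma swap_column_uncoloured (k : nat) (G H : sgraph) (p : H -> G)
    (c : H -> option 'I_k) (a : 'I_k) (T : G -> H) (x : H) :
  partial_packing p c -> (forall v, p (T v) = v) -> T (p x) = x ->
  c x = None -> (forall y, p y = p x -> c y != Some a) ->
  #|[set y | swap_column p c a T y == None]| < #|[set y | c y == None]|.
Proof.
move=> [cinj _] pT Tx cx xa.
(* An a-vertex that loses its column does so because T took the column while
   itself having none: charge that vertex of T. *)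
pose g y := if c y == Some a then T (p y) else y.
have pg y : p (g y) = p y by rewrite /g; case: ifP.
rewrite (cardsD1 x [set y | c y == None]) inE cx eqxx add1n ltnS.
rewrite -(card_in_imset (f := g)).
  apply: subset_leq_card; apply/subsetP => _ /imsetP[y yU ->]; move: yU.
  rewrite !inE /swap_column /g; case: (eqVneq y) => // yT.
  case: (c y =P Some a) => [cy|_] cN; rewrite cN andbT.
    apply: contraTneq (introT eqP cy) => e; apply: xa.
    by rewrite -[in RHS]e pT.
  by apply: contraNneq yT => ->; rewrite Tx.
move=> y z; rewrite !inE /swap_column => yU zU e.
have pyz : p y = p z by rewrite -pg e pg.
move: e yU zU; rewrite /g pyz.
case: (c y =P Some a) => [cy|_]; case: (c z =P Some a) => [cz|_] //.
- by move=> _ _ _; apply: cinj cy cz.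
- by move=> ->; rewrite eqxx.
- by move=> <-; rewrite eqxx.
Qed.

(** * Completing a packing *)

(** The column map is injective from a list of k vertices to k columns, hence
    onto, so each column meets each list exactly once. *)
Lemma full_partial_packing (k : nat) (G H : sgraph) (L : G -> {set H})
    (p : H -> G) (c : H -> option 'I_k) :
  correspondence_cover k L -> (forall x v, (x \in L v) = (p x == v)) ->
  partial_packing p c -> (forall x, c x != None) ->
  correspondence_packing L (fun i => [set x | c x == Some i]).
Proof.
move=> cL pP [cinj cind] ctot; split=> [i|i j ij]; last first.
  rewrite -setI_eq0; apply/eqP/setP => x; rewrite !inE; apply/negP.
  by case/andP => /eqP -> /eqP [ji]; rewrite ji eqxx in ij.
split=> [v|v w x y vw]; last first.
  rewrite !inE !pP => /andP[/eqP cx /eqP px] /andP[/eqP cy /eqP py].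
  by apply: (cind _ _ i); rewrite ?px ?py.
have csome x : exists j, c x = Some j.
  by case e : (c x) (ctot x) => [j|//] _; exists j.
have [y yv cy] : exists2 y, y \in L v & c y = Some i.
  have /imsetP[y yv e] : Some i \in c @: L v; last by exists y.
  have /eqP-> : c @: L v == Some @: [set: 'I_k].
    rewrite eqEcard; apply/andP; split.
      by apply/subsetP => _ /imsetP[x _ ->]; have [j ->] := csome x; rewrite imset_f.
    rewrite (card_imset _ (@Some_inj _)) cardsT card_ord card_in_imset.
      by rewrite (cover_card cL).
    move=> x y; rewrite !pP => /eqP px /eqP py; have [j cx] := csome x.
    by rewrite cx => cy; apply: (cinj _ _ j); rewrite // px py.
  by rewrite imset_f // inE.
apply/eqP/cards1P; exists y; apply/setP => z; rewrite !inE.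
apply/andP/eqP => [[/eqP cz zv]|->]; last by rewrite cy.
by apply: (cinj _ _ i) => //; move: zv yv; rewrite !pP => /eqP -> /eqP ->.
Qed.

Lemma colourable_packable (m : nat) (G : sgraph) :
  correspondence_colourable m G ->
  correspondence_packable (1 + max_degree G + m) G.
Proof.
set k := 1 + max_degree G + m => colG H L cL.
have [p pP] := cover_owner cL.
suff [c cP ctot] : exists2 c : H -> option 'I_k,
    partial_packing p c & forall x, c x != None.
  by eexists; apply: full_partial_packing cL pP cP ctot.
have extend n (c : H -> option 'I_k) : #|[set x | c x == None]| <= n ->
    partial_packing p c ->
    exists2 c : H -> option 'I_k, partial_packing p c & forall x, c x != None.
  elim: n c => [|n IH] c Un cP.
    exists c => // x; apply: contraTN Un => cx.
    by rewrite -ltnNge card_gt0; apply/set0Pn; exists x; rewrite inE.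
  have [/forallP ctot|] := boolP [forall x, c x != None]; first by exists c.
  rewrite negb_forall => /existsP[x]; rewrite negbK => /eqP cx.
  have xL : x \in L (p x) by rewrite pP.
  have [a La] := missing_column cL xL cx.
  have xa y : p y = p x -> c y != Some a.
    by move=> pyx; apply: La; rewrite pP pyx.
  have [T [Tx TP Tind]] := transversal_through cL pP colG cP xa.
  apply: (IH (swap_column p c a T)); last exact: swap_column_packing.
  rewrite -ltnS; apply: leq_trans Un.
  by apply: (swap_column_uncoloured cP _ Tx cx xa) => v; case: (TP v).
by apply: (extend _ (fun=> None) (leqnn _)); split.
Qed.

Theorem theorem10 (G : sgraph) :
  correspondence_packing_number G <=
    1 + max_degree G + correspondence_chromatic_number G.
Proof.
rewrite /correspondence_chromatic_number; case: ex_minnP => m /asboolP colG _.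
rewrite /correspondence_packing_number; case: ex_minnP => k _; apply.
by rewrite add1n addSn /=; apply/asboolP; apply: colourable_packable.
Qed.
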